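(* Let $n\geq 1$ and $k\geq 1$ be integers, let $r\in\mathbb{C}$, and let $C_r^{(k)}=\mathrm{Circ}_r(\mathbb{F}_0^{(k)},\mathbb{F}_1^{(k)},\ldots,\mathbb{F}_{n-1}^{(k)})$ be the $n\times n$ $r$-circulant matrix with first row $(\mathbb{F}_0^{(k)},\ldots,\mathbb{F}_{n-1}^{(k)})$. Then its Euclidean norm is \[ \|C_r^{(k)}\|_E=\left[\frac{n}{2}\left(n+1+(n-1)|r|^2\right)\left(\mathbb{F}_n^{(k)}\right)^2-\frac12\sum_{s=0}^{n-1}(s+1)\left(2n+s(|r|^2-1)\right)\left(\mathbb{F}_{s+1}^{(k-1)}+2\mathbb{F}_s^{(k)}\right)\mathbb{F}_{s+1}^{(k-1)}\right]^{1/2}. \]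
   Context: $F_n$ denotes the Fibonacci numbers: $F_0=0$, $F_1=1$, $F_{n+1}=F_n+F_{n-1}$. Hyperharmonic Fibonacci numbers: $\mathbb{F}_n^{(0)}=\frac{1}{F_n}$ for $n\geq1$, and for $m\geq 1$, $\mathbb{F}_n^{(m)}=\sum_{j=1}^{n}\mathbb{F}_j^{(m-1)}$ for $n\ge 1$, with $\mathbb{F}_0^{(m)}=0$. For $c_0,\ldots,c_{n-1}\in\mathbb{C}$ and $r\in\mathbb{C}$, the $r$-circulant matrix $\mathrm{Circ}_r(c_0,\ldots,c_{n-1})$ is the $n\times n$ matrix whose $(i,j)$ entry ($0\le i,j\le n-1$) is $c_{j-i}$ if $j\geq i$ and $r\,c_{n+j-i}$ if $j<i$ (first row $(c_0,\ldots,c_{n-1})$, second row $(rc_{n-1},c_0,\ldots,c_{n-2})$, etc.). The Euclidean norm is $\|A\|_E=\left(\sum_{i,j}|a_{ij}|^2\right)^{1/2}$. *)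

(* Defs.v *)
From mathcomp Require Import all_boot all_order all_algebra.
From mathcomp Require Import reals.
From mathcomp Require Import complex.

Set Implicit Arguments.
Unset Strict Implicit.
Unset Printing Implicit Defensive.

Import GRing.Theory Num.Theory.

Local Open Scope ring_scope.

Fixpoint fib (n : nat) : nat :=
  match n with
  | 0 => 0
  | n'.+1 => match n' with
             | 0 => 1
             | n''.+1 => (fib n' + fib n'')%N
             end
  end.

(* For m > 0 the sum is empty at n = 0, so hyperfib K m 0 = 0.  The order-0
   numbers are meaningful only for n >= 1 (hyperfib K 0 0 is the junk value
   0^-1 = 0, which never enters the sums). *)
Fixpoint hyperfib (K : numFieldType) (m n : nat) : K :=
  match m with
  | 0 => 1 / (fib n)%:R
  | m'.+1 => \sum_(1 <= j < n.+1) hyperfib K m' j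
  end.

(* Only the first n terms c 0, ..., c (n - 1) of the sequence c are used. *)
Definition rcirc (K : nzRingType) (n : nat) (r : K) (c : nat -> K) : 'M[K]_n :=
  \matrix_(i < n, j < n)
    if (i <= j)%N then c (j - i)%N else r * c (n + j - i)%N.

(* The norm `|z| of z : R[i] is itself an element of R[i] (a nonnegative real),
   so the Euclidean norm is also R[i]-valued; sqrtC is the nonnegative square
   root on nonnegative reals. *)
Definition enorm (R : realType) (m n : nat) (A : 'M[R[i]]_(m, n)) : R[i] :=
  sqrtC (\sum_(i < m) \sum_(j < n) `|A i j| ^+ 2).

(* Main.v *)
Require Import Defs.
From mathcomp Require Import all_boot all_order all_algebra.
From mathcomp Require Import reals.
From mathcomp Require Import complex.
From mathcomp Require Import zify ring.

Set Implicit Arguments.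
Unset Strict Implicit.
Unset Printing Implicit Defensive.

Import GRing.Theory Num.Theory.

Local Open Scope ring_scope.

(** In an [r]-circulant matrix the term [c s] occurs [n - s] times with weight
    [1] and [s] times with weight [r], so with [q = |r|^2] and [c] real the
    squared norm is the sum of [(n + s (q - 1)) (c s)^2].  The partial sums of
    the weights are [(s + 1) (2 n + s (q - 1)) / 2], and
    [a_(s+1)^2 - a_s^2 = (b_(s+1) + 2 a_s) b_(s+1)] where [a] and [b] are the
    hyperharmonic Fibonacci numbers of orders [k] and [k - 1]; summation by
    parts then gives the formula. *)

(** Each row is a cyclic shift: [s = j - i] on and right of the diagonal fills [[0, n - i)], and
    [s = n + j - i] left of it fills [[n - i, n)]. *)
Lemma sum_circulant_row (V : nmodType) (n i : nat) (F G : nat -> V) :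
  (i <= n)%N ->
  \sum_(j < n) (if (i <= j)%N then F (j - i)%N else G (n + j - i)%N) =
  \sum_(s < n) (if (i < n - s)%N then F s else G s).
Proof.
move=> le_in.
rewrite -(big_mkord xpredT
  (fun j => if (i <= j)%N then F (j - i)%N else G (n + j - i)%N)).
rewrite -(big_mkord xpredT (fun s => if (i < n - s)%N then F s else G s)).
rewrite (big_cat_nat (leq0n i) le_in) /=.
rewrite (big_cat_nat (leq0n (n - i)) (leq_subr i n)) /= addrC.
congr (_ + _).
  rewrite -[X in index_iota X n]add0n big_addn; under eq_bigr do rewrite leq_addl addnK.
  by apply: eq_big_nat => s lt_s; case: ifPn => //; lia.
rewrite -[X in index_iota X n]add0n [RHS]big_addn subKn //.
apply: eq_big_nat => j lt_j; rewrite ifF; last by lia.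
by rewrite ifF; [congr (G _); lia | lia].
Qed.

Lemma sum_circulant (V : nmodType) (n : nat) (F G : nat -> V) :
  \sum_(i < n) \sum_(j < n)
    (if (i <= j)%N then F (j - i)%N else G (n + j - i)%N) =
  \sum_(s < n) (F s *+ (n - s) + G s *+ s).
Proof.
under eq_bigr => i _ do rewrite (sum_circulant_row F G (ltnW (ltn_ord i))).
(* For fixed [s], the first [n - s] rows contribute [F s] and the last [s] rows [G s]. *)
rewrite exchange_big; apply: eq_bigr => s _ /=.
rewrite -(big_mkord xpredT (fun i => if (i < n - s)%N then F s else G s)).
rewrite (big_cat_nat (leq0n (n - s)) (leq_subr s n)) /=; congr (_ + _).
  under eq_big_nat => i /andP[_ ->] do [].
  by rewrite sumr_const_nat subn0.
under eq_big_nat => i /andP[le_i _] do rewrite ltnNge le_i /=.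
by rewrite sumr_const_nat subKn // ltnW.
Qed.

Lemma enorm_rcirc (R : realType) (n : nat) (r : R[i]) (c : nat -> R[i]) :
  enorm (rcirc n r c) =
  sqrtC (\sum_(0 <= s < n) (n%:R + s%:R * (`|r| ^+ 2 - 1)) * `|c s| ^+ 2).
Proof.
rewrite /enorm; congr sqrtC.
under eq_bigr => i _ do under eq_bigr => j _ do
  rewrite mxE (fun_if (fun z => `|z| ^+ 2)) normrM exprMn.
rewrite (sum_circulant n (fun s => `|c s| ^+ 2)
  (fun s => `|r| ^+ 2 * `|c s| ^+ 2)) big_mkord.
apply: eq_bigr => s _.
rewrite -[_ *+ (n - s)]mulr_natl -[(_ * _) *+ s]mulr_natl natrB; last exact: ltnW.
by ring.
Qed.

(** [N] is kept independent of [n] so that the weights stay fixed during the induction on [n]; only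
    afterwards is [N] set to [n%:R]. *)
Lemma sum_affine_sqr_by_parts (K : numFieldType) (N d : K) (a b : nat -> K)
    (n : nat) :
  (forall s, a s.+1 = a s + b s.+1) ->
  \sum_(0 <= s < n) (N + s%:R * d) * a s ^+ 2 =
  n%:R / 2 * (2 * N + (n%:R - 1) * d) * a n ^+ 2
  - 1 / 2 * \sum_(0 <= s < n)
      (s%:R + 1) * (2 * N + s%:R * d) * (b s.+1 + 2 * a s) * b s.+1.
Proof.
move=> a_rec; elim: n => [|n IHn]; first by rewrite !big_nil; ring.
rewrite !big_nat_recr //= IHn a_rec -natr1.
by field.
Qed.

Lemma hyperfibS (K : numFieldType) (k n : nat) :
  hyperfib K k.+1 n.+1 = hyperfib K k.+1 n + hyperfib K k n.+1.
Proof. by rewrite /= big_nat_recr. Qed.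

(** This turns the squared moduli in the norm into plain squares. *)
Lemma hyperfib_ge0 (K : numFieldType) (k n : nat) : 0 <= hyperfib K k n.
Proof.
elim: k n => [|k IHk] n /=; first by rewrite divr_ge0.
by apply: sumr_ge0.
Qed.

Theorem theorem3p5 (R : realType) (n k : nat) (r : R[i])
    (hn : (1 <= n)%N) (hk : (1 <= k)%N) :
  enorm (rcirc n r (hyperfib R[i] k)) =
  sqrtC (n%:R / 2 * (n%:R + 1 + (n%:R - 1) * `|r| ^+ 2)
           * hyperfib R[i] k n ^+ 2
         - 1 / 2 * \sum_(0 <= s < n)
             (s%:R + 1) * (2 * n%:R + s%:R * (`|r| ^+ 2 - 1))
             * (hyperfib R[i] (k - 1) s.+1 + 2 * hyperfib R[i] k s)
             * hyperfib R[i] (k - 1) s.+1).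
Proof.
case: k hk => // k _; rewrite subn1 [k.+1.-1]/= enorm_rcirc; congr sqrtC.
under eq_bigr => s _ do rewrite (ger0_norm (hyperfib_ge0 _ _ _)).
rewrite (sum_affine_sqr_by_parts _ _ _ (hyperfibS R[i] k)).
(* With [N = n] and [d = q - 1], [2 n + (n - 1) (q - 1) = n + 1 + (n - 1) q]. *)
by congr (_ * _ - _); ring.
Qed.
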